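(* For every $n\in\mathbb{N}$, $n\ge 1$, the polynomial $$A_n(\mathbf{x},\mathbf{1})=\sum_{\sigma\in\mathfrak{S}_{n+1}}\ \prod_{i\in\mathcal{DT}(\sigma)}x_i$$ is a real zero polynomial.
   Context: Permutations $\sigma\in\mathfrak{S}_{n+1}$ of $[n+1]=\{1,\dots,n+1\}$ are written in one-line notation $\sigma_1\cdots\sigma_{n+1}$. The descent top set is $\mathcal{DT}(\sigma)=\{\sigma_i\mid i\in[n],\ \sigma_i>\sigma_{i+1}\}$ and the ascent top set is $\mathcal{AT}(\sigma)=\{\sigma_{i+1}\mid i\in[n],\ \sigma_i<\sigma_{i+1}\}$; both are contained in $\{2,\dots,n+1\}$. The descents-ascents Eulerian polynomial is $A_n(\mathbf{x},\mathbf{y})=\sum_{\sigma\in\mathfrak{S}_{n+1}}\prod_{i\in\mathcal{DT}(\sigma)}x_i\prod_{j\in\mathcal{AT}(\sigma)}y_j$, and $A_n(\mathbf{x},\mathbf{1})$ is obtained from it by setting all the $y_j$ equal to $1$. A polynomial $p\in\mathbb{R}[x_1,\dots,x_m]$ is a real zero (RZ) polynomial if for all $a\in\mathbb{R}^m$ and all $\lambda\in\mathbb{C}$, $p(\lambda a)=0$ implies $\lambda\in\mathbb{R}$. *)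

(* Defs.v *)
From HB Require Import structures.
From mathcomp Require Import all_boot all_order all_algebra all_fingroup.
From mathcomp Require Import reals.
From mathcomp Require Import complex mpoly.

Set Implicit Arguments.
Unset Strict Implicit.
Unset Printing Implicit Defensive.

Import Order.TTheory GRing.Theory Num.Theory.

Local Open Scope ring_scope.
Local Open Scope complex_scope.

(* The one-line notation of a permutation of [n+1] is shifted by one: values   *)
(* and positions live in 'I_n.+1 = {0, ..., n}.  A pair of adjacent positions  *)
(* is indexed by i : 'I_n and consists of widen_ord (leqnSn n) i, of value i,  *)
(* and lift ord0 i, of value i + 1.                                            *)
Definition descent_tops (n : nat) (s : 'S_n.+1) : {set 'I_n.+1} :=
  [set s (widen_ord (leqnSn n) i) |
     i : 'I_n & (s (lift ord0 i) < s (widen_ord (leqnSn n) i))%N].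

Definition ascent_tops (n : nat) (s : 'S_n.+1) : {set 'I_n.+1} :=
  [set s (lift ord0 i) |
     i : 'I_n & (s (widen_ord (leqnSn n) i) < s (lift ord0 i))%N].

(* Hence every descent or ascent top has the form lift ord0 k with k : 'I_n.   *)
Lemma ord0_notin_descent_tops (n : nat) (s : 'S_n.+1) : ord0 \notin descent_tops s.
Proof. by apply/imsetP => -[k]; rewrite inE => + e; rewrite -e ltn0. Qed.

Lemma ord0_notin_ascent_tops (n : nat) (s : 'S_n.+1) : ord0 \notin ascent_tops s.
Proof. by apply/imsetP => -[k]; rewrite inE => + e; rewrite -e ltn0. Qed.

(* Among the n + n indeterminates, the first n are x_2, ..., x_(n+1) and the   *)
(* last n are y_2, ..., y_(n+1): for k : 'I_n, the indices lshift n k and      *)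
(* rshift n k stand for x_(k+2) and y_(k+2), attached to the 0-based value     *)
(* lift ord0 k.                                                                *)
Definition eulerian (R : comNzRingType) (n : nat) : {mpoly R[n + n]} :=
  \sum_(s : 'S_n.+1)
     (\prod_(k < n | lift ord0 k \in descent_tops s) 'X_(lshift n k)) *
     (\prod_(k < n | lift ord0 k \in ascent_tops s) 'X_(rshift n k)).

Definition eulerian_x1 (R : comNzRingType) (n : nat) : {mpoly R[n]} :=
  eulerian R n \mPo
    [tuple match split i with inl k => 'X_k | inr _ => 1 end | i < n + n].

Lemma eulerian_x1E (R : comNzRingType) (n : nat) :
  eulerian_x1 R n =
  \sum_(s : 'S_n.+1) \prod_(k < n | lift ord0 k \in descent_tops s) 'X_k.
Proof.
rewrite /eulerian_x1 /eulerian rmorph_sum /=; apply: eq_bigr => s _.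
rewrite rmorphM !rmorph_prod /= [X in _ * X]big1 ?mulr1 => [|k _].
  apply: eq_bigr => k _; rewrite comp_mpolyXU -tnth_nth tnth_mktuple.
  by rewrite -[lshift n k]/(unsplit (inl k)) unsplitK.
rewrite comp_mpolyXU -tnth_nth tnth_mktuple.
by rewrite -[rshift n k]/(unsplit (inr k)) unsplitK.
Qed.

Definition real_zero (R : realType) (m : nat) (p : {mpoly R[m]}) : Prop :=
  forall (a : 'I_m -> R) (lambda : R[i]),
    (map_mpoly (real_complex R) p).@[fun k => lambda * (a k)%:C] = 0 ->
    exists r : R, lambda = r%:C.

(* Main.v *)
(* For real a, let F_n(X) be A_n evaluated at x_c = X + a_c and y_c = X + z.    *)
(* Inserting the maximum N into a permutation multiplies its monomial by x_N   *)
(* at the front, by y_N at the end, and elsewhere replaces one of its factors  *)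
(* by x_N y_N.  Hence F_(n+1) = ((X + a_N) (X + z) F_n)'.  When Im z > 0, a    *)
(* Gauss-Lucas argument shows inductively that all roots of F_n lie in the     *)
(* open lower half-plane; in particular F_n(0) = A_n(a, z, ..., z) <> 0.  By   *)
(* homogeneity A_n(t a, 1) = t^n A_n(a, 1/t, ..., 1/t), which is thus nonzero  *)
(* if Im t < 0; the case Im t > 0 follows by changing the signs of t and a.    *)

Require Import Defs.
From mathcomp Require Import all_boot all_order all_algebra all_fingroup reals.
From mathcomp Require Import complex mpoly.
From mathcomp Require Import ring lra.

Set Implicit Arguments.
Unset Strict Implicit.
Unset Printing Implicit Defensive.

Import Order.TTheory GRing.Theory Num.Theory.

Local Open Scope ring_scope.
Local Open Scope complex_scope.

(** Permutations become words of naturals weighted by a product over adjacent letters, so that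
    inserting the maximum is a list operation. [sum_adj_prod_insert] and [sum_lift_perm] give the
    recursion [eulerian_polyS]; [roots_deriv_mul] shows that it keeps all roots in the open lower
    half-plane. [prod_descent_tops] and [sum_adj_prod_edge_neq0] transfer this to [eulerian_x1]. *)

Definition adj_prod (A : comNzRingType) (e : nat -> nat -> A) (w : seq nat) : A :=
  \prod_(i < (size w).-1) e (nth 0%N w i) (nth 0%N w i.+1).

Lemma adj_prod1 (A : comNzRingType) (e : nat -> nat -> A) c :
  adj_prod e [:: c] = 1.
Proof. by rewrite /adj_prod big_ord0. Qed.

Lemma adj_prod_cons2 (A : comNzRingType) (e : nat -> nat -> A) c d w :
  adj_prod e [:: c, d & w] = e c d * adj_prod e (d :: w).
Proof. by rewrite /adj_prod big_ord_recl. Qed.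

Definition insert_at (T : Type) (b : T) (w : seq T) (i : nat) : seq T :=
  take i w ++ b :: drop i w.

(* The two outer gaps contribute [u] and [v] times the product; an inner gap    *)
(* replaces a factor of derivative 1 by [u * v].                               *)
Lemma sum_adj_prod_insert (A : comNzRingType) (e : nat -> nat -> {poly A})
    (u v : {poly A}) (b : nat) (w : seq nat) :
  (forall c d, (e c d)^`() = 1) -> u^`() = 1 -> v^`() = 1 -> (0 < size w)%N ->
  (forall c, c \in w -> e b c = u /\ e c b = v) ->
  \sum_(i < (size w).+1) adj_prod e (insert_at b w i) =
  (u * v * adj_prod e w)^`().
Proof.
move=> de du dv; case: w => // c w _ eb.
(* [T c w] collects the gaps after the first letter [c]. Fixing [c] makes induction on [w] possible:
   the last gap gives the [v] term, the inner gaps the derivative term. *)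
pose T c w := \sum_(i < (size w).+1) adj_prod e (c :: insert_at b w i).
have TE : T c w = v * adj_prod e (c :: w) + u * v * (adj_prod e (c :: w))^`().
  elim: w c eb => [|d w IHw] c eb.
    rewrite /T big_ord1 /insert_at /= adj_prod_cons2 !adj_prod1 derivC.
    by have [|_ ->] := eb c; rewrite ?mem_head // mulr0 addr0.
  rewrite /T big_ord_recl /insert_at /= !adj_prod_cons2 derivM de mul1r.
  have -> : \sum_(i < (size w).+1)
      adj_prod e [:: c, d & take i w ++ b :: drop i w] = e c d * T d w.
    by rewrite /T mulr_sumr; apply: eq_bigr => i _; rewrite adj_prod_cons2.
  rewrite IHw => [|a ad]; last by apply: eb; rewrite inE ad orbT.
  have [|_ ->] := eb c; first exact: mem_head.
  have [|-> _] := eb d; first by rewrite inE mem_head orbT.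
  ring.
rewrite big_ord_recl /insert_at /= adj_prod_cons2.
have -> : \sum_(i < (size w).+1) adj_prod e (c :: take i w ++ b :: drop i w) = T c w
  by [].
have [|-> _] := eb c; first exact: mem_head.
rewrite TE !derivM du dv; ring.
Qed.

Definition perm_word n (s : 'S_n) : seq nat := [seq val (s i) | i <- enum 'I_n].

Lemma size_perm_word n (s : 'S_n) : size (perm_word s) = n.
Proof. by rewrite size_map size_enum_ord. Qed.

Lemma nth_perm_word n (s : 'S_n) (i : 'I_n) : nth 0%N (perm_word s) i = s i.
Proof. by rewrite (nth_map i) ?size_enum_ord // nth_ord_enum. Qed.

Lemma perm_word_lift_perm n (i : 'I_n.+1) (s : 'S_n) :
  perm_word (lift_perm i ord_max s) = insert_at n (perm_word s) i.
Proof.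
have le_in : (i <= n)%N by rewrite -ltnS.
have sz : size (take i (perm_word s)) = i.
  by rewrite size_takel // size_perm_word.
apply: (@eq_from_nth _ 0%N) => [|j].
  by rewrite size_cat /= sz size_drop !size_perm_word addnS subnKC.
rewrite size_perm_word => ltj; rewrite -[j]/(val (Ordinal ltj)).
rewrite nth_perm_word /insert_at nth_cat sz.
case: (unliftP i (Ordinal ltj)) => [k|] -> /=.
  rewrite lift_perm_lift lift_max /= /bump; case: (leqP i k) => ik.
    rewrite add1n ltnNge leqW //= subSn //= nth_drop subnKC //.
    by rewrite nth_perm_word.
  by rewrite add0n ik nth_take // nth_perm_word.
by rewrite lift_perm_id ltnn subnn.
Qed.

(** The position of the maximum recovers [i], and then the remaining values recover [s]; equal
    cardinalities turn this injection into a bijection. *)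
Lemma sum_lift_perm (V : nmodType) n (F : 'S_n.+1 -> V) :
  \sum_s F s = \sum_(s : 'S_n) \sum_(i < n.+1) F (lift_perm i ord_max s).
Proof.
rewrite pair_big /= (reindex (fun p => lift_perm p.2 ord_max p.1)) //=.
apply: onW_bij; apply: inj_card_bij => [[s i] [t j] /= est|].
  have eij : i = j.
    by apply: (@perm_inj _ (lift_perm i ord_max s)); rewrite {2}est !lift_perm_id.
  rewrite -eij in est *; congr (_, _); apply/permP => k.
  by apply: (@lift_inj _ ord_max); rewrite -!(lift_perm_lift i) est.
by rewrite card_prod !card_Sn card_ord factS mulnC.
Qed.

(* [edge a 1] yields the summands of [eulerian_x1], and [edge a z] those of     *)
(* [A_n(a, z, ..., z)].                                                        *)
Definition edge (A : Type) (a : nat -> A) (z : A) (c d : nat) : A :=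
  if (d < c)%N then a c else z.

Definition eulerian_poly (A : comNzRingType) (a : nat -> A) (z : A) (n : nat) :
    {poly A} :=
  \sum_(s : 'S_n.+1)
    adj_prod (edge (fun c => 'X + (a c)%:P) ('X + z%:P)) (perm_word s).

Lemma eulerian_poly0 (A : comNzRingType) (a : nat -> A) z :
  eulerian_poly a z 0 = 1.
Proof.
rewrite /eulerian_poly (eq_bigr (fun=> 1)) => [|s _].
  by rewrite sumr_const card_Sn.
by rewrite /adj_prod size_perm_word big_ord0.
Qed.

(** The new letter [n.+1] exceeds all others: it is a descent top before any letter and an ascent
    top after any letter. *)
Lemma eulerian_polyS (A : comNzRingType) (a : nat -> A) z n :
  eulerian_poly a z n.+1 =
  (('X + (a n.+1)%:P) * ('X + z%:P) * eulerian_poly a z n)^`().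
Proof.
have dX (c : A) : ('X + c%:P)^`() = 1 by rewrite derivD derivX derivC addr0.
rewrite /eulerian_poly sum_lift_perm mulr_sumr raddf_sum /=.
apply: eq_bigr => s _; rewrite -(@sum_adj_prod_insert _ _ _ _ n.+1) ?dX //.
- by rewrite size_perm_word; apply: eq_bigr => i _; rewrite perm_word_lift_perm.
- by move=> c d; rewrite /edge; case: ifP.
- by rewrite size_perm_word.
move=> c /mapP[i _ ->]; have lt_sn := ltn_ord (s i).
by rewrite /edge lt_sn ltnNge (ltnW lt_sn).
Qed.

Lemma Im_inv (R : rcfType) (z : R[i]) :
  complex.Im z^-1 = - complex.Im z / (complex.Re z ^+ 2 + complex.Im z ^+ 2).
Proof. by case: z => x y /=; rewrite mulNr. Qed.

Lemma Im_inv_le0 (R : rcfType) (z : R[i]) :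
  0 <= complex.Im z -> complex.Im z^-1 <= 0.
Proof.
move=> z0; rewrite Im_inv mulr_le0_ge0 ?oppr_le0 // invr_ge0.
by rewrite addr_ge0 ?sqr_ge0.
Qed.

Lemma Im_inv_lt0 (R : rcfType) (z : R[i]) :
  0 < complex.Im z -> complex.Im z^-1 < 0.
Proof.
move=> z0; rewrite Im_inv nmulr_rlt0 ?oppr_lt0 // invr_gt0.
by rewrite ltr_wpDl ?sqr_ge0 // exprn_gt0.
Qed.

(** The quotient is the sum of [(z - r)^-1] over the roots [r], and each [z - r] lies in the upper
    half-plane. *)
Lemma Im_logderiv_le0 (R : rcfType) (p : {poly R[i]}) z :
  (forall r, root p r -> complex.Im r < 0) -> 0 <= complex.Im z ->
  complex.Im (p^`().[z] / p.[z]) <= 0.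
Proof.
have [rs ->] := closed_field_poly_normal p.
move: (lead_coef p) => c; have [-> _ _|c0] := eqVneq c 0.
  by rewrite scale0r deriv0 horner0 mul0r.
move=> + z0; rewrite derivZ !hornerZ -mulf_div divff // mul1r.
elim: rs => [|r rs IHrs] roots.
  by rewrite big_nil derivC horner0 mul0r.
have Im_r : complex.Im r < 0.
  by apply: roots; rewrite rootZ // root_prod_XsubC mem_head.
rewrite big_cons derivM derivXsubC mul1r !hornerE.
set q := \prod_(_ <- _) _ in IHrs *.
have zr0 : z - r != 0.
  by apply/eqP => /subr0_eq zr; move: Im_r; rewrite -zr ltNge z0.
have IH : complex.Im (q^`().[z] / q.[z]) <= 0.
  apply: IHrs => t; rewrite rootZ // root_prod_XsubC => trs.
  by apply: roots; rewrite rootZ // root_prod_XsubC inE trs orbT.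
have q0 : q.[z] != 0.
  apply/eqP => qz; have : complex.Im z < 0.
    apply: roots; rewrite rootZ // root_prod_XsubC inE -root_prod_XsubC.
    by apply/orP; right; apply/rootP.
  by rewrite ltNge z0.
have -> : (q.[z] + (z - r) * q^`().[z]) / ((z - r) * q.[z]) =
    (z - r)^-1 + q^`().[z] / q.[z] by field; rewrite q0.
rewrite raddfD /= -[leRHS]addr0 lerD // Im_inv_le0 //.
by rewrite raddfB /= subr_ge0 (le_trans (ltW Im_r)).
Qed.

(** At a point of the closed upper half-plane the logarithmic derivative of the product has negative
    imaginary part, strictly so thanks to [b]. *)
Lemma roots_deriv_mul (R : rcfType) (p : {poly R[i]}) (a b : R[i]) :
  0 <= complex.Im a -> 0 < complex.Im b ->
  (forall r, root p r -> complex.Im r < 0) ->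
  forall r, root (('X + a%:P) * ('X + b%:P) * p)^`() r -> complex.Im r < 0.
Proof.
move=> a0 b0 roots r; rewrite ltNge; apply: contraTN => r0.
have Im_add z : complex.Im (r + z) = complex.Im r + complex.Im z by rewrite raddfD.
have p0 : p.[r] != 0 by apply/negP => /roots; rewrite ltNge r0.
have rb0 : r + b != 0.
  by apply/eqP => /(congr1 (@complex.Im R)); rewrite Im_add /= => e; lra.
rewrite /root !derivM !derivD !derivX !derivC !hornerE /=.
(* For real [a] the point [r] may be [- a], a pole of the logarithmic derivative; there the
   derivative equals [(r + b) * p.[r]]. *)
have [ra|ra0] := eqVneq (r + a) 0.
  by rewrite -addrA ra !mul0r !addr0 mulf_neq0.
apply/eqP => e.
have : (r + a)^-1 + (r + b)^-1 + p^`().[r] / p.[r] = 0.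
  apply: (mulfI (mulf_neq0 (mulf_neq0 ra0 rb0) p0)); rewrite mulr0 -e.
  by field; rewrite ra0 rb0 p0.
move=> /(congr1 (@complex.Im R)); rewrite !raddfD /= => e0.
have ra_le0 : complex.Im (r + a)^-1 <= 0 by rewrite Im_inv_le0 // Im_add addr_ge0.
have rb_lt0 : complex.Im (r + b)^-1 < 0 by rewrite Im_inv_lt0 // Im_add ltr_wpDl.
have := Im_logderiv_le0 roots r0.
lra.
Qed.

Lemma roots_eulerian_poly (R : rcfType) (a : nat -> R[i]) z n :
  (forall c, 0 <= complex.Im (a c)) -> 0 < complex.Im z ->
  forall r, root (eulerian_poly a z n) r -> complex.Im r < 0.
Proof.
move=> a0 z0; elim: n => [|n IHn] r.
  by rewrite eulerian_poly0 (negPf (root1 r)).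
by rewrite eulerian_polyS; apply: roots_deriv_mul.
Qed.

(** Injectivity of [s] lets the product over descent tops run over descent positions instead; the
    value 0 is never a descent top. *)
Lemma prod_descent_tops (A : comNzRingType) n (s : 'S_n.+1) (a : nat -> A) :
  \prod_(k < n | lift ord0 k \in descent_tops s) a k.+1 =
  adj_prod (edge a 1) (perm_word s).
Proof.
transitivity (\prod_(j in descent_tops s) a j).
  rewrite big_mkcond [RHS]big_mkcond big_ord_recl.
  by rewrite (negPf (ord0_notin_descent_tops s)) /= mul1r.
rewrite big_imset => [|i j _ _ /perm_inj/(congr1 val) /= ij]; last exact: val_inj.
rewrite /adj_prod size_perm_word /= big_mkcond; apply: eq_bigr => i _.
rewrite inE /edge -(nth_perm_word s (lift ord0 i)).
by rewrite -(nth_perm_word s (widen_ord (leqnSn n) i)).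
Qed.

Lemma adj_prod_edge_scale (A : comNzRingType) (a : nat -> A) (z t : A) w :
  adj_prod (edge (fun c => t * a c) (t * z)) w =
  t ^+ (size w).-1 * adj_prod (edge a z) w.
Proof.
rewrite /adj_prod -[X in _ ^+ X]card_ord -prodr_const -big_split.
by apply: eq_bigr => i _; rewrite /edge; case: ifP.
Qed.

Lemma eulerian_poly_at0 (A : comNzRingType) (a : nat -> A) z n :
  (eulerian_poly a z n).[0] =
  \sum_(s : 'S_n.+1) adj_prod (edge a z) (perm_word s).
Proof.
rewrite /eulerian_poly horner_sum; apply: eq_bigr => s _.
rewrite /adj_prod horner_prod; apply: eq_bigr => i _.
by rewrite /edge; case: ifP; rewrite !hornerE.
Qed.

(* By homogeneity the sum is [t ^+ n * A_n(b, t^-1, ..., t^-1)].                *)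
Lemma sum_adj_prod_edge_neq0 (R : rcfType) n (b : nat -> R) (t : R[i]) :
  complex.Im t < 0 ->
  \sum_(s : 'S_n.+1) adj_prod (edge (fun c => t * (b c)%:C) 1) (perm_word s) != 0.
Proof.
move=> t_lt0; have t0 : t != 0 by apply: contraTneq t_lt0 => ->; rewrite ltxx.
under eq_bigr => s _ do
  rewrite -(divff t0) adj_prod_edge_scale size_perm_word.
rewrite -mulr_sumr -eulerian_poly_at0 mulf_neq0 ?expf_neq0 //.
have Im_inv_t : 0 < complex.Im t^-1.
  have := @Im_inv_lt0 _ (- t); rewrite invrN !raddfN /= oppr_gt0 oppr_lt0.
  exact.
apply/negP => root0; suff : complex.Im (0 : R[i]) < 0 by rewrite ltxx.
by apply: (roots_eulerian_poly _ Im_inv_t root0) => c /=.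
Qed.

Theorem corollary6p9 (R : realType) (n : nat) (hn : (1 <= n)%N) :
  real_zero (eulerian_x1 R n).
Proof.
pose p := map_mpoly (real_complex R) (eulerian_x1 R n).
have p_neq0 (a : 'I_n -> R) (t : R[i]) :
      complex.Im t < 0 -> p.@[fun k => t * (a k)%:C] != 0.
  (* The variable of index [k] belongs to the value [k.+1], hence the shift by one. *)
  pose b c := if insub c.-1 is Some k then a k else 0.
  have bE (k : 'I_n) : b k.+1 = a k by rewrite /b /= valK.
  move=> t_lt0; rewrite /p eulerian_x1E.
  rewrite (raddf_sum (map_mpoly _)) (raddf_sum (meval _)) /=.
  under eq_bigr => s _.
    rewrite !rmorph_prod /=.
    under eq_bigr => k _ do rewrite map_mpolyX mevalXU -bE.
    rewrite (prod_descent_tops s (fun c => t * (b c)%:C)).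
    over.
  exact: sum_adj_prod_edge_neq0.
move=> a t; rewrite -/p => pt0; exists (complex.Re t).
suff : complex.Im t = 0 by case: t {pt0} => x y /= ->.
case: (ltgtP (complex.Im t) 0) => // Im_t.
  by have := p_neq0 a t Im_t; rewrite pt0 eqxx.
have := p_neq0 (fun k => - a k) (- t).
rewrite raddfN oppr_lt0 => /(_ Im_t) /eqP[]; rewrite -[RHS]pt0.
by apply: meval_eq => k; rewrite rmorphN mulrNN.
Qed.
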